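(* Let $E$ be a finite guarded recursive specification over $\mathrm{TSP}^{\bullet}$ in Greibach normal form, and let $X$ be a name defined in $E$. Then there exists a pushdown automaton $\mathcal{M}$ such that the transition system $\mathcal{T}(X)$ associated with $X$ is strongly bisimilar to the transition system $\mathcal{T}(\mathcal{M})$ associated with $\mathcal{M}$.
   Context: $\mathcal{A}_\tau=\mathcal{A}\cup\{\tau\}$ is a set of actions ($\tau$ internal). $\mathrm{TSP}^{\bullet}$ process expressions: $P::=\mathbf{0}\mid\mathbf{1}\mid a.P\mid P\bullet P\mid P+P\mid N$ ($a\in\mathcal{A}_\tau$, $N$ a name). A recursive specification $E$ is a set of equations $N\overset{def}{=}P$ with at most one per name and a defining equation for every name occurring in a right-hand side; it is guarded if every occurrence of a name in a right-hand side is within the scope of a prefix $a.$ with $a\in\mathcal{A}$ (not $\tau$). It is in Greibach normal form if every equation has the form $X=\sum_{i\in I_X}\alpha_i.\xi_i$ possibly with an additional summand $\mathbf{1}$, where $I_X$ is finite (empty sum denotes $\mathbf{0}$), $\alpha_i\in\mathcal{A}_\tau$ and each $\xi_i$ is a sequential composition (with $\bullet$) of names (the empty sequence denoting $\mathbf{1}$). Operational semantics (least relations, well-supported because of the negative premise): $\mathbf{1}\downarrow$; $a.P\xrightarrow{a}P$; $+$ inherits transitions and termination from either summand; $P_1\bullet P_2\downarrow$ if $P_1\downarrow$ and $P_2\downarrow$; $P_1\xrightarrow{a}P_1'$ implies $P_1\bullet P_2\xrightarrow{a}P_1'\bullet P_2$; if $P_1\downarrow$, $P_2\xrightarrow{a}P_2'$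 and $P_1$ has no outgoing transition, then $P_1\bullet P_2\xrightarrow{a}P_2'$; a name $N$ with $N\overset{def}{=}P$ in $E$ has the transitions and termination of $P$. $\mathcal{T}(P)$ is the transition system with states the expressions reachable from $P$, the induced transitions, initial state $P$ and terminating states those $Q$ with $Q\downarrow$. A pushdown automaton is $\mathcal{M}=(S,\Sigma,\mathcal{D},\to,\uparrow,Z,\downarrow)$ with $S$ a finite set of states, $\Sigma\subseteq\mathcal{A}_\tau$ finite, $\mathcal{D}$ a finite set of stack symbols, $\to\subseteq S\times\mathcal{D}\times\Sigma\times\mathcal{D}^*\times S$ finite (written $s\xrightarrow{a[d/\delta]}t$), initial state $\uparrow\in S$, initial stack symbol $Z\in\mathcal{D}$, accepting states $\downarrow\subseteq S$. $\mathcal{T}(\mathcal{M})$ has states $(s,\delta)$ with $s\in S,\delta\in\mathcal{D}^*$, transitions $(s,d\delta)\xrightarrow{a}(t,\delta'\delta)$ iff $s\xrightarrow{a[d/\delta']}t$, initial state $(\uparrow,Z)$, and terminating states $(s,\delta)$ with $s\in\downarrow$. A strong bisimulation on a transition system is a symmetric relation $R$ such that $sRt$ implies: if $s\xrightarrow{a}s'$ then $t\xrightarrow{a}t'$ with $s'Rt'$; and if $s\downarrow$ then $t\downarrow$. Two transition systems are strongly bisimilar if their initial states are related by a strong bisimulation on their disjoint union. *)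

(* Defs.v *)
From HB Require Import structures.
From mathcomp Require Import all_boot.
From mathcomp Require Import boolp classical_sets cardinality.

Set Implicit Arguments.
Unset Strict Implicit.
Unset Printing Implicit Defensive.

Local Open Scope classical_set_scope.

(* [None] is the internal action tau; [Some a] is the visible action a. *)
Definition act (A : Type) : Type := option A.

Section Processes.
Variables A V : Type.

Inductive proc : Type :=
| Zero
| One
| Pre of act A & proc
| Seq of proc & proc
| Alt of proc & proc
| Name of V.

(* [E (N, P)] reads "N is defined as P". *)
Definition equations : Type := set (V * proc).

Fixpoint occurs (N : V) (P : proc) : Prop :=
  match P with
  | Zero | One => False
  | Pre _ P => occurs N P
  | Seq P Q | Alt P Q => occurs N P \/ occurs N Q
  | Name M => M = N
  end.

Definition defined (E : equations) (N : V) : Prop := exists P, E (N, P).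

Definition recursive_specification (E : equations) : Prop :=
  (forall N P Q, E (N, P) -> E (N, Q) -> P = Q) /\
  (forall N P M, E (N, P) -> occurs M P -> defined E M).

(* A tau-prefix does not guard. *)
Fixpoint guarded_expr (P : proc) : Prop :=
  match P with
  | Zero | One => True
  | Pre (Some _) _ => True
  | Pre None P => guarded_expr P
  | Seq P Q | Alt P Q => guarded_expr P /\ guarded_expr Q
  | Name _ => False
  end.

Definition guarded (E : equations) : Prop :=
  forall N P, E (N, P) -> guarded_expr P.

(* Sequential compositions and sums are taken with arbitrary bracketing. *)
Inductive nonempty_name_seq : proc -> Prop :=
| nonempty_name_seq_name N : nonempty_name_seq (Name N)
| nonempty_name_seq_seq P Q :
    nonempty_name_seq P -> nonempty_name_seq Q -> nonempty_name_seq (Seq P Q).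

Definition name_seq (P : proc) : Prop := P = One \/ nonempty_name_seq P.

(* The boolean records whether the summand 1, allowed at most once, is
   present. *)
Inductive greibach_sum : bool -> proc -> Prop :=
| greibach_sum_zero : greibach_sum false Zero
| greibach_sum_one : greibach_sum true One
| greibach_sum_pre (a : act A) P : name_seq P -> greibach_sum false (Pre a P)
| greibach_sum_alt (b c : bool) P Q : ~~ (b && c) ->
    greibach_sum b P -> greibach_sum c Q -> greibach_sum (b || c) (Alt P Q).

Definition greibach_normal_form (E : equations) : Prop :=
  forall N P, E (N, P) -> exists b, greibach_sum b P.

Section Semantics.
Variable E : equations.

Inductive term : proc -> Prop :=
| term_one : term One
| term_altl P Q : term P -> term (Alt P Q)
| term_altr P Q : term Q -> term (Alt P Q)
| term_seq P Q : term P -> term Q -> term (Seq P Q)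
| term_name N P : E (N, P) -> term P -> term (Name N).

(* [derives H P a Q]: the transition P --a--> Q is derivable by the rules from
   the hypotheses that the expressions in [H] have no outgoing transition. *)
Inductive derives (H : set proc) : proc -> act A -> proc -> Prop :=
| derives_pre a P : derives H (Pre a P) a P
| derives_altl P Q a P' : derives H P a P' -> derives H (Alt P Q) a P'
| derives_altr P Q a Q' : derives H Q a Q' -> derives H (Alt P Q) a Q'
| derives_seql P Q a P' : derives H P a P' -> derives H (Seq P Q) a (Seq P' Q)
| derives_seqr P Q a Q' :
    term P -> H P -> derives H Q a Q' -> derives H (Seq P Q) a Q'
| derives_name N P a P' : E (N, P) -> derives H P a P' -> derives H (Name N) a P'.

(* Well-supported proofs of negative literals, in the sense of van Glabbeek: P
   has no outgoing transition if every derivation of one, from any set [H] of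
   negative hypotheses, relies on a hypothesis about some R that is refuted by
   a transition of R having itself a well-supported proof. *)
Inductive refuses (P : proc) : Prop :=
| refuses_intro :
    (forall (H : set proc) a P', derives H P a P' ->
       exists2 R, H R & exists b R', derives refuses R b R') ->
    refuses P.

Definition step : proc -> act A -> proc -> Prop := derives refuses.

Inductive reachable (P : proc) : proc -> Prop :=
| reachable_refl : reachable P P
| reachable_step Q a Q' : reachable P Q -> step Q a Q' -> reachable P Q'.

End Semantics.
End Processes.

Arguments Zero {A V}.
Arguments One {A V}.

(* For guarded specifications the negative premises are decided, so that [step]
   satisfies the rules read literally, with "P has no outgoing transition"
   interpreted by [step] itself. *)
Section GuardedSemantics.
Variables (A V : Type) (E : equations A V).

Let decided (P : proc A V) : Prop :=
  (refuses E P /\ forall a Q, ~ step E P a Q) \/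
  (~ refuses E P /\ exists a Q, step E P a Q).

Lemma derives_mono (H H' : set (proc A V)) P a Q :
  H `<=` H' -> derives E H P a Q -> derives E H' P a Q.
Proof.
move=> HH'; elim=> *;
  [ exact: derives_pre | exact: derives_altl | exact: derives_altr
  | exact: derives_seql | by apply: derives_seqr => //; exact: HH'
  | by apply: derives_name; eassumption ].
Qed.

Let decided_zero : decided (Zero : proc A V).
Proof.
left; split; last by move=> a Q; inversion 1.
by apply: refuses_intro => H a Q; inversion 1.
Qed.

Let decided_one : decided (One : proc A V).
Proof.
left; split; last by move=> a Q; inversion 1.
by apply: refuses_intro => H a Q; inversion 1.
Qed.

Let decided_pre a P : decided (Pre a P).
Proof.
right; split; last by exists a, P; exact: derives_pre.
by case=> /(_ set0 a P (derives_pre _ _ _ _)) [].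
Qed.

Let decided_alt P Q : decided P -> decided Q -> decided (Alt P Q).
Proof.
move=> [[rP nP]|[nrP [a [P' sP]]]]; last first.
  move=> _; right; split; last by exists a, P'; apply: derives_altl.
  case=> h; apply: nrP; apply: refuses_intro => H b R d.
  exact: (h H b R (derives_altl _ d)).
move=> [[rQ nQ]|[nrQ [a [Q' sQ]]]].
  left; split.
    apply: refuses_intro => H a R d; inversion d; subst.
      by case: rP => h; apply: h; eassumption.
    by case: rQ => h; apply: h; eassumption.
  by move=> a R d; inversion d; subst; [apply: nP; eassumption | apply: nQ; eassumption].
right; split; last by exists a, Q'; apply: derives_altr.
case=> h; apply: nrQ; apply: refuses_intro => H b R d.
exact: (h H b R (derives_altr _ d)).
Qed.

Let decided_seq P Q : decided P -> decided Q -> decided (Seq P Q).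
Proof.
move=> [[rP nP]|[nrP [a [P' sP]]]]; last first.
  move=> _; right; split; last by exists a, (Seq P' Q); apply: derives_seql.
  case=> h; apply: nrP; apply: refuses_intro => H b R d.
  exact: (h H b _ (derives_seql Q d)).
have rej H a R : derives E H P a R ->
    exists2 R, H R & exists b R', derives E (refuses E) R b R'.
  by case: rP => h; exact: h.
have [tP|ntP] := pselect (term E P); last first.
  move=> _; left; split.
    by apply: refuses_intro => H a R d; inversion d; subst => //; apply: rej; eassumption.
  by move=> a R d; inversion d; subst => //; apply: nP; eassumption.
move=> [[rQ nQ]|[nrQ [a [Q' sQ]]]].
  left; split.
    apply: refuses_intro => H a R d; inversion d; subst.
      by apply: rej; eassumption.
    by case: rQ => h; apply: h; eassumption.
  by move=> a R d; inversion d; subst; [apply: nP; eassumption | apply: nQ; eassumption].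
right; split; last by exists a, Q'; apply: derives_seqr.
case=> h; apply: nrQ; apply: refuses_intro => H b R d.
have d' : derives E (H `|` [set P]) (Seq P Q) b R.
  apply: derives_seqr => //; first by right.
  by apply: derives_mono d; exact: subsetUl.
case: (h _ _ _ d') => S [HS|->] [c [S' sS]]; first by exists S => //; exists c, S'.
by case: (nP c S' sS).
Qed.

Hypotheses (E_spec : recursive_specification E) (E_guarded : guarded E).

Let decided_guarded P : guarded_expr P -> decided P.
Proof.
elim: P => [||a P _|P IP Q IQ|P IP Q IQ|N] /= g; [exact: decided_zero|exact: decided_one|exact: decided_pre| | |by []].
  by case: g => /IP ? /IQ ?; exact: decided_seq.
by case: g => /IP ? /IQ ?; exact: decided_alt.
Qed.

Let decided_name N : decided (Name A N).
Proof.
have [[P EP]|nE] := pselect (defined E N); last first.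
  left; split; first by apply: refuses_intro => H a Q; inversion 1; subst; case: nE; exists P.
  by move=> a Q; inversion 1; subst; case: nE; exists P.
have uP Q : E (N, Q) -> Q = P by move=> EQ; case: E_spec => /(_ N Q P EQ EP).
case: (decided_guarded (E_guarded EP)) => [[rP nP]|[nrP [a [P' sP]]]].
  left; split.
    apply: refuses_intro => H a Q d; inversion d as [| | | | |N' P0 a' Q' E0 d0]; subst.
    by rewrite (uP _ E0) in d0; case: rP => h; exact: (h _ _ _ d0).
  move=> a Q d; inversion d as [| | | | |N' P0 a' Q' E0 d0]; subst.
  by rewrite (uP _ E0) in d0; exact: (nP _ _ d0).
right; split; last by exists a, P'; apply: derives_name EP sP.
case=> h; apply: nrP; apply: refuses_intro => H b R d.
exact: (h H b R (derives_name EP d)).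
Qed.

Lemma refusesP P : refuses E P <-> forall a Q, ~ step E P a Q.
Proof.
have : decided P.
  elim: P => [||a P _|P IP Q IQ|P IP Q IQ|N];
    [exact: decided_zero|exact: decided_one|exact: decided_pre
    |exact: decided_seq|exact: decided_alt|exact: decided_name].
case=> [[]|[nr [a [Q s]]]]; first by [].
by split=> // h; case: (h a Q s).
Qed.

End GuardedSemantics.

Record lts (A : Type) : Type := Lts {
  lts_state : Type;
  lts_trans : lts_state -> act A -> lts_state -> Prop;
  lts_init : lts_state;
  lts_term : lts_state -> Prop
}.

Definition proc_lts (A V : Type) (E : equations A V) (P : proc A V) : lts A :=
  {| lts_state := {Q : proc A V | reachable E P Q};
     lts_trans := fun Q a Q' => step E (sval Q) a (sval Q');
     lts_init := exist _ P (reachable_refl E P);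
     lts_term := fun Q => term E (sval Q) |}.

Record pda (A : Type) : Type := Pda {
  pda_state : finType;
  pda_alphabet : set (act A);
  pda_alphabet_finite : finite_set pda_alphabet;
  pda_stack : finType;
  (* [(s, d, a, delta, t)]: in s, pop d, perform a, push delta, move to t. *)
  pda_trans : set (pda_state * pda_stack * act A * seq pda_stack * pda_state);
  pda_trans_finite : finite_set pda_trans;
  pda_trans_alphabet :
    forall s d a delta t, pda_trans (s, d, a, delta, t) -> pda_alphabet a;
  pda_init : pda_state;
  pda_init_stack : pda_stack;
  pda_accept : {set pda_state}
}.

(* The top of the stack is the head of the list. *)
Inductive pda_step (A : Type) (M : pda A) :
    pda_state M * seq (pda_stack M) -> act A ->
    pda_state M * seq (pda_stack M) -> Prop :=
| pda_step_intro s d a delta' t delta : pda_trans (s, d, a, delta', t) ->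
    pda_step (s, d :: delta) a (t, delta' ++ delta).

Definition pda_lts (A : Type) (M : pda A) : lts A :=
  {| lts_state := (pda_state M * seq (pda_stack M))%type;
     lts_trans := @pda_step A M;
     lts_init := (pda_init M, [:: pda_init_stack M]);
     lts_term := fun c => c.1 \in pda_accept M |}.

Definition strong_bisimulation (A S : Type) (trans : S -> act A -> S -> Prop)
    (tm : S -> Prop) (R : S -> S -> Prop) : Prop :=
  (forall s t, R s t -> R t s) /\
  (forall s t, R s t ->
    (forall a s', trans s a s' -> exists2 t', trans t a t' & R s' t') /\
    (tm s -> tm t)).

Definition union_trans (A : Type) (T1 T2 : lts A)
    (s : lts_state T1 + lts_state T2) (a : act A)
    (t : lts_state T1 + lts_state T2) : Prop :=
  match s, t with
  | inl s, inl t => lts_trans s a t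
  | inr s, inr t => lts_trans s a t
  | _, _ => False
  end.

Definition union_term (A : Type) (T1 T2 : lts A)
    (s : lts_state T1 + lts_state T2) : Prop :=
  match s with
  | inl s => lts_term s
  | inr s => lts_term s
  end.

Definition strongly_bisimilar (A : Type) (T1 T2 : lts A) : Prop :=
  exists R : lts_state T1 + lts_state T2 -> lts_state T1 + lts_state T2 -> Prop,
    strong_bisimulation (@union_trans A T1 T2) (@union_term A T1 T2) R /\
    R (inl (lts_init T1)) (inr (lts_init T2)).

(* Main.v *)
Require Import Defs.
From mathcomp Require Import all_boot.
From mathcomp Require Import boolp classical_sets cardinality.

Set Implicit Arguments.
Unset Strict Implicit.
Unset Printing Implicit Defensive.

Local Open Scope classical_set_scope.

(** Every expression reachable from a name is a sequential composition of
    names. A name that terminates and has no transition is transparent, so the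
    composition behaves as the list of its remaining names, of which only the
    first can act: this list is the stack. Since acceptance of a pushdown
    automaton depends on the control state alone, each stack symbol also records
    whether all names below it terminate; the control state is the corresponding
    bit for the whole stack, and can be recomputed when the top is popped. *)

(** [V] may be infinite while stack symbols form a [finType], so only the names in a finite set are
    coded faithfully. Anything outside it gets the index [size s], which decodes to the default
    [x0]. *)
Lemma finite_set_retract (T : Type) (B : set T) (x0 : T) : finite_set B ->
  exists n (code : T -> 'I_n.+1) (dec : 'I_n.+1 -> T),
    forall x, B x -> dec (code x) = x.
Proof.
move=> /(@finite_seqP {classic T})[s ->].
exists (size s), (fun x => inord (index (x : {classic T}) s)),
  (fun i => nth (x0 : {classic T}) s i) => x /= xs.
by rewrite inordK ?nth_index // ltnS index_size.
Qed.

(** * Sequences of names and their stacks *)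

Section Sequences.
Variables (A V : Type) (E : equations A V).

(** Unlike [name_seq], this allows [One] inside a composition. A name may step to [One] and leave
    [Seq One Q], so this form is the one preserved by transitions. *)
Fixpoint defined_name_seq (P : proc A V) : Prop :=
  match P with
  | One => True
  | Name N => defined E N
  | Seq P Q => defined_name_seq P /\ defined_name_seq Q
  | _ => False
  end.

Definition terminating (N : V) : bool := `[< term E (Name A N) >].

Definition transparent (N : V) : bool :=
  `[< term E (Name A N) /\ refuses E (Name A N) >].

(** Transparent names are erased because a pushdown automaton pops only while performing an action:
    such a name on top would block the names below it. *)
Fixpoint stack_of (P : proc A V) : seq V :=
  match P with
  | Name N => nseq (~~ transparent N) N
  | Seq P Q => stack_of P ++ stack_of Q
  | _ => [::]
  end.

(** In a Greibach sum only the prefixes act, so the target of a transition is the sequence under one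
    of them. *)
Lemma greibach_derives H b P a Q : greibach_sum b P -> derives E H P a Q ->
  name_seq Q /\ forall M, occurs M Q -> occurs M P.
Proof.
move=> g; elim: g a Q => [||a P' nP|b1 b2 P1 P2 _ _ IH1 _ IH2] c Q d;
  inversion d; subst => //.
- have [nQ oQ] := IH1 _ _ ltac:(eassumption).
  by split=> // M /oQ; left.
- have [nQ oQ] := IH2 _ _ ltac:(eassumption).
  by split=> // M /oQ; right.
Qed.

Lemma finite_greibach_derives H b P : greibach_sum b P ->
  finite_set [set x | derives E H P x.1 x.2].
Proof.
elim=> [||a Q _|b1 b2 P1 P2 _ _ IH1 _ IH2].
- by apply: (sub_finite_set _ (finite_set0 _)) => x d; inversion d.
- by apply: (sub_finite_set _ (finite_set0 _)) => x d; inversion d.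
- apply: (sub_finite_set _ (finite_set1 (a, Q))) => -[c R] /= d.
  by inversion d.
- apply: (@sub_finite_set _ _ ([set x | derives E H P1 x.1 x.2] `|`
                               [set x | derives E H P2 x.1 x.2])).
    by move=> x d; inversion d; subst; [left|right].
  by rewrite finite_setU.
Qed.

Hypotheses (E_spec : recursive_specification E) (E_guarded : guarded E)
  (E_gnf : greibach_normal_form E).

Lemma name_seq_defined P :
  name_seq P -> (forall M, occurs M P -> defined E M) -> defined_name_seq P.
Proof.
case=> [-> //|]; elim=> [N|P1 P2 _ IH1 _ IH2] /= oP; first exact: oP.
by split; [apply: IH1 => M oM | apply: IH2 => M oM]; apply: oP; [left|right].
Qed.

Lemma step_name_seq N a Q : step E (Name A N) a Q -> defined_name_seq Q.
Proof.
move=> d; inversion d as [| | | | |N' P a' Q' EP dP]; subst.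
have [b g] := E_gnf EP.
have [nQ oQ] := greibach_derives g dP.
by apply: name_seq_defined nQ _ => M /oQ; exact: E_spec.2 EP.
Qed.

Lemma finite_step_name N : finite_set [set x | step E (Name A N) x.1 x.2].
Proof.
have [[P EP]|nE] := pselect (defined E N); last first.
  apply: (sub_finite_set _ (finite_set0 _)) => x d.
  by inversion d; subst; case: nE; exists P.
have [b g] := E_gnf EP.
apply: (sub_finite_set _ (finite_greibach_derives (refuses E) g)) => x d.
inversion d as [| | | | |N' P' a' Q' EP' dP]; subst.
by rewrite (E_spec.1 _ _ _ EP EP').
Qed.

Lemma step_nontransparent N a Q :
  step E (Name A N) a Q -> transparent N = false.
Proof.
move=> s; apply/negP => /asboolP[_ /(refusesP E_spec E_guarded)].
by move=> /(_ _ _ s).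
Qed.

(** * Termination and transitions read off the stack *)

Lemma term_stack P : defined_name_seq P ->
  term E P <-> all terminating (stack_of P).
Proof.
elim: P => //= [_|P IP Q IQ [/IP eP /IQ eQ]|N _].
- by split=> // _; exact: term_one.
- rewrite all_cat; split=> [t|/andP[/eP tP /eQ tQ]]; last exact: term_seq.
  by inversion t; subst; apply/andP; split; [exact/eP|exact/eQ].
- rewrite /transparent; case: asboolP => [[t _]|nt] //=.
  by rewrite andbT; split=> /asboolP.
Qed.

(** This turns the premises on [P] in the second transition rule for [Seq P Q] into emptiness of the
    stack of [P]. *)
Lemma stack_nil P : defined_name_seq P ->
  (stack_of P = [::]) <-> (term E P /\ refuses E P).
Proof.
have rE := refusesP E_spec E_guarded.
elim: P => //= [_|P IP Q IQ [/IP eP /IQ eQ]|N _].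
- split=> // _; split; first exact: term_one.
  by apply/rE => a Q d; inversion d.
- split=> [|[t /rE r]].
    case: (stack_of P) eP => //= -[/(_ erefl)[tP rP] _] /eQ[tQ rQ].
    split; first exact: term_seq.
    apply/rE => a R d; inversion d; subst.
      by move/rE: rP; apply; eassumption.
    by move/rE: rQ; apply; eassumption.
  inversion t; subst.
  (* A step of [P] would lift to the composition. Once [P] is known to refuse, a step of [Q] lifts
     as well. *)
  have rP : refuses E P.
    by apply/rE => a R s; apply: (r a (Seq R Q)); exact: derives_seql.
  have -> : stack_of P = [::] by apply/eP.
  apply/eQ; split=> //; apply/rE => a R s.
  by apply: (r a R); exact: derives_seqr.
- by rewrite /transparent; case: asboolP.
Qed.

Lemma stack_top_defined P N rest :
  defined_name_seq P -> stack_of P = N :: rest -> defined E N.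
Proof.
elim: P rest => [||b P _|P IP Q IQ|P _ Q _|M] rest //=.
- move=> [wP wQ]; case sP: (stack_of P) => [|N' r] /=; first exact: IQ.
  by case=> eN _; apply: (IP r wP); rewrite sP eN.
- by move=> dM; case: transparent => //= -[<-].
Qed.

Lemma step_stack P a Q : defined_name_seq P -> step E P a Q ->
  defined_name_seq Q /\
  exists N rest Q0, [/\ stack_of P = N :: rest, defined E N,
    step E (Name A N) a Q0 & stack_of Q = stack_of Q0 ++ rest].
Proof.
elim: P Q => [||b P _|P IP P2 IQ|P _ P2 _|N] R //=.
- by move=> _ d; inversion d.
- move=> [wP wQ] d; inversion d as [| | |? ? ? P' dP|? ? ? ? tP rP dQ|]; subst.
    have [wP' [N [rest [Q0 [sP dN s sP']]]]] := IP _ wP dP.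
    split=> //; exists N, (rest ++ stack_of P2), Q0.
    by split; rewrite ?sP //= sP' catA.
  have -> : stack_of P = [::] by apply/stack_nil.
  exact: IQ.
- move=> dN s; split; first exact: step_name_seq s.
  exists N, [::], R; split; rewrite ?cats0 //.
  by rewrite (step_nontransparent s).
Qed.

Lemma stack_step P N rest a Q0 : defined_name_seq P ->
  stack_of P = N :: rest -> step E (Name A N) a Q0 ->
  exists2 Q, step E P a Q & stack_of Q = stack_of Q0 ++ rest.
Proof.
elim: P rest => [||b P _|P IP Q IQ|P _ Q _|M] rest //=.
- move=> [wP wQ] eS s; case sP: (stack_of P) eS => [|N' rest'] /= eS.
    have [tP rP] := (stack_nil wP).1 sP.
    by have [R sR eR] := IQ _ wQ eS s; exists R => //; exact: derives_seqr.
  case: eS => eN eR; rewrite eN in sP.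
  have [R sR eR'] := IP _ wP sP s.
  exists (Seq R Q); first exact: derives_seql.
  by rewrite /= eR' -catA eR.
- move=> _; case: transparent => //= -[<- <-] s.
  by exists Q0 => //; rewrite cats0.
Qed.

(** * The automaton and its simulation of the process *)

Section Automaton.
Variables (D : finType) (code : V -> D) (dec : D -> V).
Hypothesis codeK : forall N, defined E N -> dec (code N) = N.

(* [b] tells whether everything below [l] on the stack terminates. *)
Fixpoint annotate (b : bool) (l : seq V) : seq (D * bool) :=
  if l is N :: l' then
    (code N, all terminating l' && b) :: annotate b l'
  else [::].

(** The annotation of [l1] depends on what lies below it through a single bit, so the bit in the
    popped symbol suffices to annotate the names pushed in its place. *)
Lemma annotate_cat b l1 l2 :
  annotate b (l1 ++ l2) = annotate (all terminating l2 && b) l1 ++ annotate b l2.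
Proof. by elim: l1 => //= N l1 ->; rewrite all_cat andbA. Qed.

Definition rule (x : bool * (D * bool) * (act A * proc A V)) :
    bool * (D * bool) * act A * seq (D * bool) * bool :=
  (x.1.1, x.1.2, x.2.1, annotate x.1.2.2 (stack_of x.2.2),
   all terminating (stack_of x.2.2) && x.1.2.2).

Definition enabled : set (bool * (D * bool) * (act A * proc A V)) :=
  [set x | step E (Name A (dec x.1.2.1)) x.2.1 x.2.2].

(** There are finitely many pairs of control state and stack symbol, and each name is finitely
    branching by the normal form. *)
Lemma enabled_finite : finite_set enabled.
Proof.
apply: (@sub_finite_set _ _ (\bigcup_(c in [set: bool * (D * bool)])
  ((fun y => (c, y)) @` [set y | step E (Name A (dec c.2.1)) y.1 y.2]))).
  by move=> [c y] s; exists c => //; exists y.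
apply: bigcup_finite; first exact: finite_finset.
by move=> c _; apply: finite_image; exact: finite_step_name.
Qed.

Lemma rules_finite : finite_set (rule @` enabled).
Proof. by apply: finite_image; exact: enabled_finite. Qed.

Definition alphabet : set (act A) := (fun x => x.2.1) @` enabled.

Lemma alphabet_finite : finite_set alphabet.
Proof. by apply: finite_image; exact: enabled_finite. Qed.

Lemma rules_alphabet s d a delta t :
  (rule @` enabled) (s, d, a, delta, t) -> alphabet a.
Proof. by case=> x ex [_ _ <- _ _]; exists x. Qed.

(** The initial symbol carries [true] because nothing lies below it, and the empty composition
    terminates. *)
Definition stack_pda (X : V) : pda A :=
  {| pda_alphabet_finite := alphabet_finite;
     pda_trans_finite := rules_finite;
     pda_trans_alphabet := rules_alphabet;
     pda_init := terminating X;
     pda_init_stack := (code X, true);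
     pda_accept := [set true]%SET |}.

(* The garbage is nonempty only if the initial name is transparent: it is then
   the initial stack symbol. *)
Definition represents (P : proc A V) (c : bool * seq (D * bool)) : Prop :=
  [/\ defined_name_seq P, c.1 = all terminating (stack_of P) &
    exists2 garbage, c.2 = annotate true (stack_of P) ++ garbage &
      all (fun x => transparent (dec x.1)) garbage].

Lemma represents_init X : defined E X ->
  represents (Name A X) (terminating X, [:: (code X, true)]).
Proof.
move=> dX; split=> //=.
  rewrite /transparent; case: asboolP => [[t _]|_] /=; last by rewrite andbT.
  exact/asboolP.
case tX: (transparent X) => /=; last by exists [::].
by exists [:: (code X, true)] => //=; rewrite codeK // tX.
Qed.

Lemma represents_term X P c :
  represents P c -> term E P <-> lts_term (l := pda_lts (stack_pda X)) c.
Proof.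
case=> wP e1 _; rewrite /= inE eqb_id e1; exact: term_stack.
Qed.

Lemma represents_step X P c a Q : represents P c -> step E P a Q ->
  exists2 c', pda_step (M := stack_pda X) c a c' & represents Q c'.
Proof.
case: c => b delta [wP /= _ [g -> gt]] s.
have [wQ [N [rest [Q0 [sP dN s0 sQ]]]]] := step_stack wP s.
rewrite sP /= andbT.
(* The rule pops [N] and pushes the stack of [Q0]; the garbage [g] stays at the bottom. *)
exists (all terminating (stack_of Q),
        annotate (all terminating rest) (stack_of Q0) ++ annotate true rest ++ g).
  apply: pda_step_intro; exists (b, (code N, all terminating rest), (a, Q0)).
    by rewrite /enabled /= codeK.
  by rewrite /rule /= sQ all_cat.
split=> //; exists g => //=.
by rewrite sQ annotate_cat andbT catA.
Qed.

Lemma represented_step X P c a c' : represents P c ->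
  pda_step (M := stack_pda X) c a c' ->
  exists2 Q, step E P a Q & represents Q c'.
Proof.
move=> [wP _ [g e2 gt]] d.
inversion d as [s [x b] a' delta' t delta tr ec ea ec']; subst c a' c'.
case: tr => -[[b' [x' b'']] [a'' Q0]] en [_ ex eb ea <- <-].
move: en; rewrite /enabled /= in ex eb ea *; rewrite ex ea eb => s0.
move: e2 => /=; case sP: (stack_of P) => [|N rest] /=.
  (* With no name left, the automaton would have to pop garbage, but a transparent name has no
     transition to justify a rule. *)
  by move=> eg; move: gt; rewrite -eg /= (step_nontransparent s0).
rewrite andbT => -[exN ebN ->].
(* Decoding the popped symbol returns [N] only because [N] is defined. *)
have dN := stack_top_defined wP sP.
rewrite exN codeK // in s0.
have [Q sQ eQ] := stack_step wP sP s0.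
exists Q => //; split=> /=.
- by have [] := step_stack wP sQ.
- by rewrite eQ all_cat ebN.
- by exists g => //; rewrite eQ annotate_cat andbT catA ebN.
Qed.

End Automaton.
End Sequences.

(** * Strong bisimilarity of the two transition systems *)

Lemma simulation_bisimilar (A : Type) (T1 T2 : lts A)
    (R : lts_state T1 -> lts_state T2 -> Prop) :
  (forall s t, R s t -> lts_term s <-> lts_term t) ->
  (forall s t a s', R s t -> lts_trans s a s' ->
    exists2 t', lts_trans t a t' & R s' t') ->
  (forall s t a t', R s t -> lts_trans t a t' ->
    exists2 s', lts_trans s a s' & R s' t') ->
  R (lts_init T1) (lts_init T2) -> strongly_bisimilar T1 T2.
Proof.
move=> tm fwd bwd Ri.
exists (fun x y => match x, y with
  | inl s, inr t | inr t, inl s => R s t | _, _ => False end); split=> //.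
split=> [[s|t] [s'|t']|[s|t] [s'|t']] //= Rst; split=> [a|].
- case=> // s1 /(fwd _ _ _ _ Rst)[t1 ? ?]; by exists (inr t1).
- exact: (tm _ _ Rst).1.
- case=> // t1 /(bwd _ _ _ _ Rst)[s1 ? ?]; by exists (inl s1).
- exact: (tm _ _ Rst).2.
Qed.

Theorem theorem2 (A V : Type) (E : equations A V)
  (E_spec : recursive_specification E) (E_finite : finite_set E)
  (E_guarded : guarded E) (E_gnf : greibach_normal_form E)
  (X : V) (X_defined : defined E X) :
  exists M : pda A, strongly_bisimilar (proc_lts E (Name A X)) (pda_lts M).
Proof.
(* The defined names are the first components of the finitely many equations; [X] serves as the
   default value of [dec]. *)
have [n [code [dec codeK]]] := finite_set_retract X (finite_image fst E_finite).
have codeE N : defined E N -> dec (code N) = N.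
  by case=> P EP; apply: codeK; exists (N, P).
pose M := stack_pda E_spec E_gnf code dec X; exists M.
apply: (@simulation_bisimilar _ (proc_lts E (Name A X)) (pda_lts M)
  (fun P c => represents E code dec (sval P) c)).
- by move=> P c; exact: represents_term.
- move=> P c a Q rP s.
  by have := represents_step E_spec E_guarded E_gnf codeE X rP s.
- move=> [P rP] c a c' /= rc s'.
  have [Q s rQ] := represented_step E_guarded codeE rc s'.
  (* States of the process system carry a proof of reachability, which is extended by the matching
     step. *)
  by exists (exist _ Q (reachable_step rP s)).
- exact: represents_init.
Qed.
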